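(* Let $\alpha_L,\alpha_R,\mu_L,\mu_R,\gamma_{RL},\gamma_{LR},\delta_L,\delta_R,\rho>0$ and consider on $\mathcal T=\{(L,R,A)\in\mathbb{R}^3: L,R,A\ge0,\ L+R+A\le1\}$ the autonomous system \[ \begin{aligned} \dot L&=\alpha_L L C+\gamma_{RL} R C+\delta_L A L-\mu_L L,\\ \dot R&=\alpha_R R C+\gamma_{LR} L C+\delta_R A R-\mu_R R,\\ \dot A&=-\delta_L A L-\delta_R A R-\rho A, \end{aligned}\qquad C=1-L-R-A. \] Let $K=\begin{pmatrix}\alpha_L&\gamma_{RL}\\ \gamma_{LR}&\alpha_R\end{pmatrix}$, $M=\mathrm{diag}(\mu_L,\mu_R)$ and $\mathcal R_{\mathrm{rad}}=\lambda_{\mathrm{PF}}(M^{-1}K)$ (the Perron root). Then: (i) If $\mathcal R_{\mathrm{rad}}\le1$, the equilibrium $E_0=(0,0,0)$ is globally asymptotically stable on $\mathcal T$. (ii) If $\mathcal R_{\mathrm{rad}}>1$, let $E_1=(L^*,R^*,0)$ be the unique equilibrium of the system with $L^*>0$ and $R^*>0$. The axis $\Gamma=\{(L,R,A)\in\mathcal T: L=R=0\}$ is forward invariant and every trajectory starting on $\Gamma$ converges to $E_0$; every trajectory starting in $\mathcal T\setminus\Gamma$ converges to $E_1$ as $t\to\infty$.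
   Context: $L,R,C,A$ are left-radical, right-radical, centrist and (excess crisis-induced) disengaged shares of an electorate, with $L+R+C+A=1$. This is the post-shock system (external shock intensity zero). *)

(* Defs.v *)
From Stdlib Require Import Reals.
From Coquelicot Require Import Coquelicot.
Open Scope R_scope.

Record params := Params {
  alphaL : R; alphaR : R; muL : R; muR : R;
  gammaRL : R; gammaLR : R; deltaL : R; deltaR : R; rho : R }.

Definition params_pos (p : params) : Prop :=
  0 < alphaL p /\ 0 < alphaR p /\ 0 < muL p /\ 0 < muR p /\
  0 < gammaRL p /\ 0 < gammaLR p /\ 0 < deltaL p /\ 0 < deltaR p /\ 0 < rho p.

Definition Cshare (L Rr A : R) : R := 1 - L - Rr - A.

Definition fL (p : params) (L Rr A : R) : R :=
  alphaL p * L * Cshare L Rr A + gammaRL p * Rr * Cshare L Rr A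
  + deltaL p * A * L - muL p * L.
Definition fR (p : params) (L Rr A : R) : R :=
  alphaR p * Rr * Cshare L Rr A + gammaLR p * L * Cshare L Rr A
  + deltaR p * A * Rr - muR p * Rr.
Definition fA (p : params) (L Rr A : R) : R :=
  - deltaL p * A * L - deltaR p * A * Rr - rho p * A.

Definition in_T (L Rr A : R) : Prop :=
  0 <= L /\ 0 <= Rr /\ 0 <= A /\ L + Rr + A <= 1.

Definition in_Gamma (L Rr A : R) : Prop := in_T L Rr A /\ L = 0 /\ Rr = 0.

Definition is_equilibrium (p : params) (L Rr A : R) : Prop :=
  fL p L Rr A = 0 /\ fR p L Rr A = 0 /\ fA p L Rr A = 0.

Definition is_solution (p : params) (L Rr A : R -> R) : Prop :=
  forall t, 0 <= t ->
    is_derive L t (fL p (L t) (Rr t) (A t)) /\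
    is_derive Rr t (fR p (L t) (Rr t) (A t)) /\
    is_derive A t (fA p (L t) (Rr t) (A t)).

Definition dist3 (x1 y1 z1 x2 y2 z2 : R) : R :=
  sqrt ((x1 - x2)^2 + (y1 - y2)^2 + (z1 - z2)^2).

Definition converges_to (L Rr A : R -> R) (Le Re Ae : R) : Prop :=
  is_lim L p_infty Le /\ is_lim Rr p_infty Re /\ is_lim A p_infty Ae.

Definition GAS_on_T (p : params) (Le Re Ae : R) : Prop :=
  (forall eps, 0 < eps -> exists delta, 0 < delta /\
     forall L Rr A : R -> R, is_solution p L Rr A -> in_T (L 0) (Rr 0) (A 0) ->
       dist3 (L 0) (Rr 0) (A 0) Le Re Ae < delta ->
       forall t, 0 <= t -> dist3 (L t) (Rr t) (A t) Le Re Ae < eps) /\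
  (forall L Rr A : R -> R, is_solution p L Rr A -> in_T (L 0) (Rr 0) (A 0) ->
     converges_to L Rr A Le Re Ae).

(* Perron root of the 2x2 nonnegative matrix [[a, b], [c, d]]:
   the largest real eigenvalue (= spectral radius, by Perron-Frobenius). *)
Definition is_eigenvalue2 (a b c d r : R) : Prop := (a - r) * (d - r) - b * c = 0.
Definition is_perron_root2 (a b c d r : R) : Prop :=
  is_eigenvalue2 a b c d r /\ forall s, is_eigenvalue2 a b c d s -> s <= r.

(* R_rad = lambda_PF(M^{-1} K), K = [[aL, gRL],[gLR, aR]], M = diag(muL, muR). *)
Definition is_Rrad (p : params) (r : R) : Prop :=
  is_perron_root2 (alphaL p / muL p) (gammaRL p / muL p)
                  (gammaLR p / muR p) (alphaR p / muR p) r.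

(* Main.v *)
Require Import Defs.
From Stdlib Require Import Reals.
From Coquelicot Require Import Coquelicot.
From Stdlib Require Import Lra Psatz.
Open Scope R_scope.

(* Write l for the Perron root, u = l muL - alphaL and v = l muR - alphaR, so that
   u, v > 0 and u v = gammaRL gammaLR.  The share A decays exponentially.

   If l <= 1, the left eigenvector (gammaLR, u) gives a linear Lyapunov function whose
   derivative is bounded by minus a multiple of its square, up to a term in A.

   If l > 1, use the coordinates N = L + R and x = L / N, with equilibrium (Ns, xs) and
   deviations X = N - Ns, Y = x - xs.  Up to terms in A the system becomes
     N' / N = - a X + eps Y,   x' = - Phi Y - b X,
   with a, b, Phi functions of x, eps constant, and a, Phi, a Phi + eps b positive on
   [0, 1].  For a suitable positive weight G, the function
     N - Ns - Ns ln (N / Ns) + int_{xs}^x G(s) (s - xs) ds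
   plus a multiple of A therefore decays exponentially along every trajectory with
   N > 0. *)

(** * Differential inequalities and limits at infinity *)

Lemma derive_nonpos_decr (f df : R -> R) (a b : R) :
  a <= b -> (forall t, a <= t <= b -> is_derive f t (df t)) ->
  (forall t, a <= t <= b -> df t <= 0) -> f b <= f a.
Proof.
intros Hab Hd Hn.
destruct (MVT_gen f a b df) as [c [Hc E]].
- intros x; rewrite Rmin_left, Rmax_right by lra; intros; apply Hd; lra.
- intros x; rewrite Rmin_left, Rmax_right by lra; intros Hx.
  apply derivable_continuous_pt.
  exists (df x); apply is_derive_Reals, Hd; lra.
- rewrite Rmin_left, Rmax_right in Hc by lra.
  specialize (Hn c Hc); nra.
Qed.

(** The product [f t * exp (- k * t)] is nonincreasing. The rate [k] may have either sign: a
    negative one gives decay, and a negated function gives lower bounds. *)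
Lemma gronwall (f df : R -> R) (k T : R) :
  0 <= T -> (forall t, 0 <= t <= T -> is_derive f t (df t)) ->
  (forall t, 0 <= t <= T -> df t <= k * f t) -> f T <= f 0 * exp (k * T).
Proof.
intros HT Hd Hk.
assert (H : f T * exp (- k * T) <= f 0 * exp (- k * 0)).
{ apply (derive_nonpos_decr (fun t => f t * exp (- k * t))
           (fun t => df t * exp (- k * t) + f t * (- k * exp (- k * t)))); auto.
  - intros t Ht.
    apply (is_derive_mult f (fun s => exp (- k * s))); auto.
    + auto_derive; auto; ring.
    + intros; apply Rmult_comm.
  - intros t Ht; specialize (Hk t Ht).
    pose proof (exp_pos (- k * t)); nra. }
rewrite Rmult_0_r, exp_0, Rmult_1_r in H.
pose proof (exp_pos (k * T)) as Hp.
apply Rmult_le_compat_r with (r := exp (k * T)) in H; [|lra].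
rewrite Rmult_assoc, <- exp_plus in H.
replace (- k * T + k * T) with 0 in H by ring.
rewrite exp_0 in H; lra.
Qed.

Lemma is_lim_of_sqr (f h : R -> R) (l : R) :
  (forall t, 0 < t -> (f t - l) ^ 2 <= h t) -> is_lim h p_infty 0 ->
  is_lim f p_infty l.
Proof.
intros Hf Hh.
apply is_lim_spec; intros eps.
apply is_lim_spec in Hh.
destruct (Hh (mkposreal (eps ^ 2) (pow_lt _ 2 (cond_pos eps)))) as [M HM]; simpl in HM.
exists (Rmax M 0); intros x Hx.
pose proof (Rmax_l M 0); pose proof (Rmax_r M 0).
specialize (HM x ltac:(lra)); specialize (Hf x ltac:(lra)).
apply Rabs_def2 in HM.
destruct eps as [e He]; simpl in *.
apply Rabs_def1; nra.
Qed.

Lemma is_lim_scal_exp_neg (c k : R) :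
  0 < k -> is_lim (fun t => c * exp (- k * t)) p_infty 0.
Proof.
intros Hk.
replace (Finite 0) with (Rbar_mult c 0) by (simpl; f_equal; ring).
apply (is_lim_scal_l (fun t => exp (- k * t)) c p_infty 0).
apply (is_lim_comp exp (fun t => - k * t) p_infty 0 m_infty).
- apply is_lim_exp_m.
- replace m_infty with (Rbar_mult (- k) p_infty).
  + apply (is_lim_scal_l (fun t => t)), is_lim_id.
  + simpl. destruct (Rle_dec 0 (- k)); [exfalso; lra|reflexivity].
- exists 0; intros; discriminate.
Qed.

Lemma is_lim_scal_inv (c : R) : is_lim (fun t => c * / t) p_infty 0.
Proof.
replace (Finite 0) with (Rbar_mult c 0) by (simpl; f_equal; ring).
apply (is_lim_scal_l (fun t => / t) c p_infty 0).
apply (is_lim_inv (fun t => t) p_infty p_infty); [apply is_lim_id|discriminate].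
Qed.

(** Since [f] is nonincreasing, [f s >= f t] on [[0, t]], so [f] falls there at rate at least
    [k * f t ^ 2]. Using the fixed value [f t] avoids dividing by [f], which may vanish. *)
Lemma decay_of_quadratic_ineq (f df : R -> R) (k : R) :
  0 < k -> (forall t, 0 <= t -> 0 <= f t) ->
  (forall t, 0 <= t -> is_derive f t (df t)) ->
  (forall t, 0 <= t -> df t <= - k * f t ^ 2) ->
  forall t, 0 < t -> f t ^ 2 <= f 0 / k * / t.
Proof.
intros Hk Hf Hd Hq t Ht.
assert (Hm : forall s, 0 <= s <= t -> f t <= f s).
{ intros s Hs; apply (derive_nonpos_decr f df); [lra| |].
  - intros; apply Hd; lra.
  - intros r Hr; specialize (Hq r ltac:(lra)); pose proof (pow2_ge_0 (f r)); nra. }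
assert (H : f t + k * f t ^ 2 * t <= f 0 + k * f t ^ 2 * 0).
{ apply (derive_nonpos_decr (fun s => f s + k * f t ^ 2 * s)
           (fun s => df s + k * f t ^ 2)); [lra| |].
  - intros s Hs. apply (is_derive_plus f (fun s => k * f t ^ 2 * s)).
    + apply Hd; lra.
    + auto_derive; auto; ring.
  - intros s Hs; specialize (Hq s ltac:(lra)); specialize (Hm s Hs).
    specialize (Hf t ltac:(lra)).
    assert (f t ^ 2 <= f s ^ 2) by (apply pow_incr; lra). nra. }
specialize (Hf t ltac:(lra)).
apply Rmult_le_reg_r with (k * t); [nra|].
replace (f 0 / k * / t * (k * t)) with (f 0) by (field; lra).
nra.
Qed.

(** * Quadratic bounds and the weight of the Lyapunov function *)

(** The difference between [f] and each comparison parabola vanishes at [x0] and is monotone on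
    either side of it. *)
Lemma quadratic_bounds (f g : R -> R) (x0 m M lo hi : R) :
  lo <= x0 <= hi -> f x0 = 0 ->
  (forall x, lo <= x <= hi -> is_derive f x (g x * (x - x0))) ->
  (forall x, lo <= x <= hi -> m <= g x <= M) ->
  forall x, lo <= x <= hi ->
    m / 2 * (x - x0) ^ 2 <= f x <= M / 2 * (x - x0) ^ 2.
Proof.
intros H0 Hf Hd Hg x Hx.
(* The sign [s] and the coefficient [c] cover four comparisons: lower and upper bound, to the right
   and to the left of [x0]. *)
assert (D : forall (s c : R) y, lo <= y <= hi ->
  is_derive (fun y => s * f y + c * (y - x0) ^ 2) y
    (s * (g y * (y - x0)) + c * (2 * (y - x0)))).
{ intros s c y Hy.
  apply (is_derive_plus (fun y => s * f y) (fun y => c * (y - x0) ^ 2)).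
  - apply (is_derive_scal f y s), Hd, Hy.
  - auto_derive; auto; ring. }
destruct (Rle_dec x0 x) as [Hle|Hle].
- split.
  + assert (- 1 * f x + m / 2 * (x - x0) ^ 2 <= - 1 * f x0 + m / 2 * (x0 - x0) ^ 2).
    { apply (derive_nonpos_decr _ _ _ _ Hle (fun y Hy => D (-1) (m / 2) y ltac:(lra))).
      intros y Hy; specialize (Hg y ltac:(lra)); nra. }
    rewrite Hf in *; lra.
  + assert (1 * f x + - M / 2 * (x - x0) ^ 2 <= 1 * f x0 + - M / 2 * (x0 - x0) ^ 2).
    { apply (derive_nonpos_decr _ _ _ _ Hle (fun y Hy => D 1 (- M / 2) y ltac:(lra))).
      intros y Hy; specialize (Hg y ltac:(lra)); nra. }
    rewrite Hf in *; lra.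
- assert (Hge : x <= x0) by lra. split.
  + assert (1 * f x0 + - m / 2 * (x0 - x0) ^ 2 <= 1 * f x + - m / 2 * (x - x0) ^ 2).
    { apply (derive_nonpos_decr _ _ _ _ Hge (fun y Hy => D 1 (- m / 2) y ltac:(lra))).
      intros y Hy; specialize (Hg y ltac:(lra)); nra. }
    rewrite Hf in *; lra.
  + assert (- 1 * f x0 + M / 2 * (x0 - x0) ^ 2 <= - 1 * f x + M / 2 * (x - x0) ^ 2).
    { apply (derive_nonpos_decr _ _ _ _ Hge (fun y Hy => D (-1) (M / 2) y ltac:(lra))).
      intros y Hy; specialize (Hg y ltac:(lra)); nra. }
    rewrite Hf in *; lra.
Qed.

Lemma continuous_pos_bounds (f : R -> R) :
  (forall x, 0 <= x <= 1 -> continuous f x) ->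
  (forall x, 0 <= x <= 1 -> 0 < f x) ->
  exists m M, 0 < m /\ 0 < M /\ forall x, 0 <= x <= 1 -> m <= f x <= M.
Proof.
intros Hc Hp.
assert (Hc' : forall c, 0 <= c <= 1 -> continuity_pt f c).
{ intros c Hx; apply continuity_pt_filterlim, Hc, Hx. }
destruct (continuity_ab_min f 0 1 ltac:(lra) Hc') as [xm [Hm Im]].
destruct (continuity_ab_maj f 0 1 ltac:(lra) Hc') as [xM [HM IM]].
exists (f xm), (f xM); repeat split; auto; apply Hp; assumption.
Qed.

(** The form has the matrix with rows [(p, - k / 2)] and [(- k / 2, r)]. The constant is its
    determinant over its trace, which is at most the smallest eigenvalue and is continuous in the
    coefficients. *)
Lemma quadratic_form_lower_bound (p k r X Y : R) :
  0 < p -> 0 < r -> k ^ 2 < 4 * p * r ->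
  (4 * p * r - k ^ 2) / (4 * (p + r)) * (X ^ 2 + Y ^ 2)
  <= p * X ^ 2 - k * X * Y + r * Y ^ 2.
Proof.
intros Hp Hr Hk.
set (c := (4 * p * r - k ^ 2) / (4 * (p + r))).
assert (Ec : c * (p + r) = p * r - k ^ 2 / 4) by (unfold c; field; lra).
assert (Hpc : 0 < p - c) by (pose proof (pow2_ge_0 k); nra).
(* By the choice of [c], this determinant is exactly [c ^ 2]. *)
assert (Hdet : 0 <= (p - c) * (r - c) - k ^ 2 / 4).
{ replace ((p - c) * (r - c) - k ^ 2 / 4)
    with (p * r - k ^ 2 / 4 - c * (p + r) + c ^ 2) by ring.
  rewrite Ec; pose proof (pow2_ge_0 c); lra. }
assert (0 <= (p - c) * ((p - c) * X ^ 2 - k * X * Y + (r - c) * Y ^ 2)).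
{ replace ((p - c) * ((p - c) * X ^ 2 - k * X * Y + (r - c) * Y ^ 2))
    with (((p - c) * X - k / 2 * Y) ^ 2 + ((p - c) * (r - c) - k ^ 2 / 4) * Y ^ 2)
    by field.
  pose proof (pow2_ge_0 ((p - c) * X - k / 2 * Y)); pose proof (pow2_ge_0 Y); nra. }
nra.
Qed.

(** Composition with this projection extends a function from [[0, 1]] to the whole line and keeps
    its continuity and its bounds, so that the weight [G] has an antiderivative everywhere. *)
Definition clamp (x : R) : R := Rmax 0 (Rmin 1 x).

Lemma clamp_range (x : R) : 0 <= clamp x <= 1.
Proof.
unfold clamp; split; [apply Rmax_l|].
apply Rmax_lub; [lra|apply Rmin_l].
Qed.

Lemma clamp_id (x : R) : 0 <= x <= 1 -> clamp x = x.
Proof. intros; unfold clamp; rewrite Rmin_right, Rmax_right; lra. Qed.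

Lemma continuous_clamp (x : R) : continuous clamp x.
Proof.
(* Minimum and maximum are rewritten with absolute values, a form whose continuity [reg] proves. *)
apply continuous_ext with (fun x => (0 + (1 + x - Rabs (1 - x)) / 2
  + Rabs (0 - (1 + x - Rabs (1 - x)) / 2)) / 2).
- intros y; unfold clamp, Rmax, Rmin.
  destruct (Rle_dec 1 y); destruct (Rle_dec 0 _);
  unfold Rabs; repeat destruct (Rcase_abs _); lra.
- apply continuity_pt_filterlim; reg.
Qed.

(* [4 a G Phi - (eps - G b)^2] is quadratic in [G] with positive discriminant
   [16 a Phi psi], where [psi = a Phi + eps b].  For [kap = 0] the weight [G] below is
   [eps^2 / (psi + a Phi)], the harmonic mean of its roots; [kap > 0] only serves to keep
   [G] positive when [eps = 0]. *)
Lemma lyapunov_weight (a b Phi : R -> R) (eps : R) :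
  (forall x, continuous a x) -> (forall x, continuous b x) ->
  (forall x, continuous Phi x) ->
  (forall x, 0 <= x <= 1 -> 0 < a x) -> (forall x, 0 <= x <= 1 -> 0 < Phi x) ->
  (forall x, 0 <= x <= 1 -> 0 < a x * Phi x + eps * b x) ->
  exists (G : R -> R) (c0 g1 g2 : R),
    0 < c0 /\ 0 < g1 /\ 0 < g2 /\ (forall x, continuous G x) /\
    (forall x, g1 <= G x <= g2) /\
    forall x X Y, 0 <= x <= 1 ->
      - a x * X ^ 2 + (eps - G x * b x) * X * Y - G x * Phi x * Y ^ 2
      <= - c0 * (X ^ 2 + Y ^ 2).
Proof.
intros Ca Cb CP Pa PP Ppsi.
set (psi := fun x => a x * Phi x + eps * b x).
set (kap := fun x => 4 * (a x * Phi x * psi x) / (1 + b x ^ 2)).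
set (den := fun x => psi x + a x * Phi x).
set (G := fun x => (eps ^ 2 + kap x) / den x).
assert (Pap : forall x, 0 <= x <= 1 -> 0 < a x * Phi x).
{ intros; apply Rmult_lt_0_compat; auto. }
assert (Pk : forall x, 0 <= x <= 1 -> 0 < kap x).
{ intros x Hx; unfold kap; apply Rdiv_lt_0_compat.
  - pose proof (Pap x Hx); pose proof (Ppsi x Hx : 0 < psi x).
    pose proof (Rmult_lt_0_compat _ _ H H0); lra.
  - pose proof (pow2_ge_0 (b x)); lra. }
assert (Pd : forall x, 0 <= x <= 1 -> 0 < den x).
{ intros x Hx; pose proof (Pap x Hx); pose proof (Ppsi x Hx : 0 < psi x); unfold den; lra. }
assert (PG : forall x, 0 <= x <= 1 -> 0 < G x).
{ intros x Hx; unfold G; apply Rdiv_lt_0_compat; auto.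
  pose proof (Pk x Hx); pose proof (pow2_ge_0 eps); lra. }
assert (Capx : forall x, continuous (fun x => a x * Phi x) x).
{ intros; apply (continuous_mult a Phi); auto. }
assert (Cpsi : forall x, continuous psi x).
{ intros; apply (continuous_plus (fun x => a x * Phi x) (fun x => eps * b x)); auto.
  apply (continuous_scal_r eps b); auto. }
assert (Ck : forall x, continuous kap x).
{ intros x; unfold kap, Rdiv.
  apply (continuous_mult (fun x => 4 * (a x * Phi x * psi x)) (fun x => / (1 + b x ^ 2))).
  - apply (continuous_scal_r 4 (fun x => a x * Phi x * psi x)).
    apply (continuous_mult (fun x => a x * Phi x) psi); auto.
  - apply continuous_Rinv_comp; [|pose proof (pow2_ge_0 (b x)); lra].
    apply (continuous_plus (fun _ => 1) (fun x => b x ^ 2)); [apply continuous_const|].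
    apply continuous_ext with (fun x => b x * b x); [intros y; simpl; ring|].
    apply (continuous_mult b b); auto. }
assert (CG : forall x, 0 <= x <= 1 -> continuous G x).
{ intros x Hx; unfold G, Rdiv.
  apply (continuous_mult (fun x => eps ^ 2 + kap x) (fun x => / den x)).
  - apply (continuous_plus (fun _ => eps ^ 2) kap); auto; apply continuous_const.
  - apply continuous_Rinv_comp; [|pose proof (Pd x Hx); lra].
    apply (continuous_plus psi (fun x => a x * Phi x)); auto. }
assert (Disc : forall x, 0 <= x <= 1 -> (eps - G x * b x) ^ 2 < 4 * a x * (G x * Phi x)).
{ intros x Hx.
  pose proof (Pd x Hx) as Hd; pose proof (Pk x Hx) as Hk; pose proof (Pap x Hx) as Hap.
  pose proof (Ppsi x Hx : 0 < psi x) as Hps.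
  assert (EG : G x * den x = eps ^ 2 + kap x) by (unfold G; field; lra).
  assert (Ek : kap x * (1 + b x ^ 2) = 4 * (a x * Phi x * psi x)).
  { unfold kap; field; pose proof (pow2_ge_0 (b x)); lra. }
  assert (Epsi : psi x = a x * Phi x + eps * b x) by reflexivity.
  assert (Eden : den x = psi x + a x * Phi x) by reflexivity.
  apply Rmult_lt_reg_r with (den x ^ 2); [apply pow_lt; lra|].
  replace ((eps - G x * b x) ^ 2 * den x ^ 2)
    with ((eps * den x - (G x * den x) * b x) ^ 2) by ring.
  replace (4 * a x * (G x * Phi x) * den x ^ 2)
    with (4 * (a x * Phi x) * (G x * den x) * den x) by ring.
  rewrite EG, Eden.
  set (P := a x * Phi x) in *.
  assert (Eb : eps * b x = psi x - P) by lra.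
  set (q := psi x) in *. set (k := kap x) in *. set (B := b x) in *.
  assert (HP : 0 < P * q) by (apply Rmult_lt_0_compat; lra).
  (* By the choice of [kap], [4 * (P * q)] equals [k * (1 + B ^ 2)], so the term in [2 * k] alone
     exceeds the left side. *)
  assert (I : k ^ 2 * B ^ 2 < (eps ^ 2 + 2 * k) * (4 * (P * q))).
  { rewrite <- Ek. pose proof (pow2_ge_0 B). pose proof (pow2_ge_0 eps).
    assert (0 < k * k) by nra.
    assert (0 <= eps ^ 2 * (k * (1 + B ^ 2))) by (apply Rmult_le_pos; nra).
    nra. }
  (* With [q = P + eps * B], splitting off the square leaves exactly the positive gap of [I]. *)
  replace (4 * P * (eps ^ 2 + k) * (q + P))
   with ((eps * (q + P) - (eps ^ 2 + k) * B) ^ 2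
         + ((eps ^ 2 + 2 * k) * (4 * (P * q)) - k ^ 2 * B ^ 2)); [lra|].
  replace q with (P + eps * B) by lra. ring. }
(* This is the constant of [quadratic_form_lower_bound] at [x]; its minimum over [[0, 1]] will be
   [c0]. *)
assert (Pc : forall x, 0 <= x <= 1 ->
   0 < (4 * a x * (G x * Phi x) - (eps - G x * b x) ^ 2) / (4 * (a x + G x * Phi x))).
{ intros x Hx; pose proof (Disc x Hx); pose proof (Pa x Hx).
  assert (0 < G x * Phi x) by (apply Rmult_lt_0_compat; auto).
  apply Rdiv_lt_0_compat; lra. }
assert (Cq : forall x, 0 <= x <= 1 -> continuous (fun x =>
   (4 * a x * (G x * Phi x) - (eps - G x * b x) ^ 2) / (4 * (a x + G x * Phi x))) x).
{ intros x Hx.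
  assert (CGP : continuous (fun x => G x * Phi x) x).
  { apply (continuous_mult G Phi); auto. }
  unfold Rdiv.
  apply (continuous_mult (fun x => 4 * a x * (G x * Phi x) - (eps - G x * b x) ^ 2)
    (fun x => / (4 * (a x + G x * Phi x)))).
  + apply (continuous_minus (fun x => 4 * a x * (G x * Phi x)) (fun x => (eps - G x * b x) ^ 2)).
    * apply (continuous_mult (fun x => 4 * a x) (fun x => G x * Phi x)); auto.
      apply (continuous_scal_r 4 a); auto.
    * assert (continuous (fun x => eps - G x * b x) x).
      { apply (continuous_minus (fun _ => eps) (fun x => G x * b x)); [apply continuous_const|].
        apply (continuous_mult G b); auto. }
      apply continuous_ext with (fun x => (eps - G x * b x) * (eps - G x * b x)); [intros y; simpl; ring|].
      apply (continuous_mult (fun x => eps - G x * b x) (fun x => eps - G x * b x)); auto.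
  + apply continuous_Rinv_comp.
    * apply (continuous_scal_r 4 (fun x => a x + G x * Phi x)).
      apply (continuous_plus a (fun x => G x * Phi x)); auto.
    * pose proof (Pa x Hx); pose proof (Rmult_lt_0_compat _ _ (PG x Hx) (PP x Hx)); lra. }
destruct (continuous_pos_bounds G CG PG) as [g1 [g2 [Hg1 [Hg2 HG]]]].
destruct (continuous_pos_bounds _ Cq Pc) as [c0 [c1 [Hc0 [_ Hc]]]].
exists (fun x => G (clamp x)), c0, g1, g2.
repeat split; auto.
- intros x; apply (continuous_comp clamp G); [apply continuous_clamp|].
  apply CG, clamp_range.
- apply HG, clamp_range.
- apply HG, clamp_range.
- intros x X Y Hx; rewrite clamp_id by auto.
  pose proof (quadratic_form_lower_bound (a x) (eps - G x * b x) (G x * Phi x) X Y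
    (Pa x Hx) (Rmult_lt_0_compat _ _ (PG x Hx) (PP x Hx)) (Disc x Hx)) as HQ.
  pose proof (proj1 (Hc x Hx)) as HC.
  pose proof (pow2_ge_0 X); pose proof (pow2_ge_0 Y).
  apply Rmult_le_compat_r with (r := X ^ 2 + Y ^ 2) in HC; lra.
Qed.

(** * Negative parts and forward invariance of the simplex *)

(** Squaring smooths the corner at [0]: the first-order remainder is at most [h ^ 2] in every sign
    case. *)
Lemma is_derive_sqr_Rmin (x : R) : is_derive (fun y => Rmin y 0 ^ 2) x (2 * Rmin x 0).
Proof.
apply is_derive_Reals; intros e He.
exists (mkposreal e He); simpl; intros h Hh0 Hh.
assert (I : Rabs (Rmin (x + h) 0 ^ 2 - Rmin x 0 ^ 2 - 2 * Rmin x 0 * h) <= h ^ 2).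
{ apply Rabs_le; unfold Rmin; destruct (Rle_dec (x + h) 0), (Rle_dec x 0); nra. }
replace ((Rmin (x + h) 0 * (Rmin (x + h) 0 * 1) - Rmin x 0 * (Rmin x 0 * 1)) / h
         - 2 * Rmin x 0)
  with ((Rmin (x + h) 0 ^ 2 - Rmin x 0 ^ 2 - 2 * Rmin x 0 * h) / h) by (field; auto).
unfold Rdiv; rewrite Rabs_mult, Rabs_inv.
assert (0 < Rabs h) by (apply Rabs_pos_lt; auto).
apply Rle_lt_trans with (2 := Hh).
apply Rmult_le_reg_r with (Rabs h); auto.
rewrite Rmult_assoc, Rinv_l, Rmult_1_r by lra.
replace (Rabs h * Rabs h) with (h ^ 2); auto.
rewrite <- (pow2_abs h); ring.
Qed.

Lemma is_derive_sqr_Rmin_comp (f : R -> R) (t df : R) :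
  is_derive f t df -> is_derive (fun s => Rmin (f s) 0 ^ 2) t (2 * Rmin (f t) 0 * df).
Proof.
intros Hf.
replace (2 * Rmin (f t) 0 * df) with (df * (2 * Rmin (f t) 0)) by ring.
apply (is_derive_comp (fun y => Rmin y 0 ^ 2) f); auto using is_derive_sqr_Rmin.
Qed.

(** Bounds a solution on a compact time interval before any invariance is known; the bound enters
    the Gronwall rate. *)
Lemma derivable_bounded (f df : R -> R) (T : R) :
  0 <= T -> (forall t, 0 <= t <= T -> is_derive f t (df t)) ->
  exists B, 0 <= B /\ forall t, 0 <= t <= T -> Rabs (f t) <= B.
Proof.
intros HT Hd.
destruct (continuity_ab_maj (fun t => Rabs (f t)) 0 T HT) as [x [Hx _]].
- intros c Hc; apply continuity_pt_filterlim.
  apply (continuous_comp f Rabs); [|apply continuous_Rabs].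
  apply @ex_derive_continuous; exists (df c); auto.
- exists (Rabs (f x)); split; auto using Rabs_pos.
Qed.

Lemma Rmin_0_mul_self (x : R) : Rmin x 0 * x = Rmin x 0 ^ 2.
Proof. unfold Rmin; destruct (Rle_dec x 0); ring. Qed.

(** Since [Rmin x 0 <= 0], replacing [y] by [Rmin y 0] can only increase the product; then the
    inequality of means applies. *)
Lemma Rmin_0_mul_le (x y : R) : Rmin x 0 * y <= (Rmin x 0 ^ 2 + Rmin y 0 ^ 2) / 2.
Proof.
pose proof (pow2_ge_0 (x - y)); pose proof (pow2_ge_0 x).
unfold Rmin; destruct (Rle_dec x 0), (Rle_dec y 0); nra.
Qed.

Lemma Rmin_0_mul3_le (x y z B : R) :
  Rabs y <= B -> Rabs z <= B ->
  Rmin x 0 * (y * z) <= B * (Rmin x 0 ^ 2 + Rmin y 0 ^ 2 + Rmin z 0 ^ 2).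
Proof.
intros Hy Hz.
apply Rabs_le_between in Hy; apply Rabs_le_between in Hz.
assert (HB : 0 <= B) by lra.
assert (E : forall w, Rmin w 0 <= 0 /\ 0 <= w - Rmin w 0 /\ w - Rmin w 0 <= Rabs w).
{ intros w; unfold Rmin; destruct (Rle_dec w 0); pose proof (Rabs_pos w);
  pose proof (Rle_abs w); lra. }
destruct (E y) as [Y1 [Y2 _]]; destruct (E z) as [Z1 [Z2 _]]; destruct (E x) as [X1 _].
set (ny := Rmin y 0) in *; set (nz := Rmin z 0) in *; set (nx := Rmin x 0) in *.
assert (Y3 : y - ny <= B) by (unfold ny, Rmin; destruct (Rle_dec y 0); lra).
assert (Z3 : z - nz <= B) by (unfold nz, Rmin; destruct (Rle_dec z 0); lra).
assert (I1 : nx * (y * z) <= nx * (ny * (z - nz) + (y - ny) * nz)).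
{ apply Rmult_le_compat_neg_l; auto. nra. }
assert (I2 : nx * ny * (z - nz) <= (nx ^ 2 + ny ^ 2) / 2 * B).
{ apply Rmult_le_compat; try lra; [nra|].
  pose proof (pow2_ge_0 (nx - ny)); lra. }
assert (I3 : nx * nz * (y - ny) <= (nx ^ 2 + nz ^ 2) / 2 * B).
{ apply Rmult_le_compat; try lra; [nra|].
  pose proof (pow2_ge_0 (nx - nz)); lra. }
pose proof (pow2_ge_0 ny); pose proof (pow2_ge_0 nz).
assert (0 <= B * ny ^ 2) by nra. assert (0 <= B * nz ^ 2) by nra.
lra.
Qed.

Lemma Rmin_0_sqr_mul_le (x c K : R) : c <= K -> Rmin x 0 * (c * x) <= K * Rmin x 0 ^ 2.
Proof.
intros H; replace (Rmin x 0 * (c * x)) with (c * (Rmin x 0 * x)) by ring.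
rewrite Rmin_0_mul_self; apply Rmult_le_compat_r; auto using pow2_ge_0.
Qed.

(* The sum of the squared negative parts of [L], [R], [A] and [C] satisfies a linear
   differential inequality and vanishes at time [0]. *)
Lemma in_T_invariant (p : params) (L Rr A : R -> R) :
  params_pos p -> is_solution p L Rr A -> in_T (L 0) (Rr 0) (A 0) ->
  forall t, 0 <= t -> in_T (L t) (Rr t) (A t).
Proof.
destruct p as [aL aR mL mR g c dL dR rh]; unfold params_pos, is_solution, fL, fR, fA; simpl.
intros (HaL & HaR & HmL & HmR & Hg & Hc & HdL & HdR & Hrh) Hs H0 T HT.
destruct (derivable_bounded L _ T HT (fun t Ht => proj1 (Hs t (proj1 Ht)))) as [BL [HBL BL']].
destruct (derivable_bounded Rr _ T HT (fun t Ht => proj1 (proj2 (Hs t (proj1 Ht))))) as [BR [HBR BR']].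
destruct (derivable_bounded A _ T HT (fun t Ht => proj2 (proj2 (Hs t (proj1 Ht))))) as [BA [HBA BA']].
set (B := 1 + BL + BR + BA).
set (S := aL + aR + mL + mR + g + c + dL + dR + rh).
set (C := fun t => Cshare (L t) (Rr t) (A t)).
(* The [delta] terms cancel, so [C] too satisfies an equation with a multiple of itself plus inflow
   from the other shares. *)
assert (dC : forall t, 0 <= t -> is_derive C t
   (- (aL * L t + g * Rr t + aR * Rr t + c * L t) * C t + mL * L t + mR * Rr t + rh * A t)).
{ intros t Ht; destruct (Hs t Ht) as (D1 & D2 & D3).
  unfold C, Cshare.
  evar_last.
  - apply @is_derive_minus; [|apply D3].
    apply @is_derive_minus; [|apply D2].
    apply @is_derive_minus; [|apply D1]. apply @is_derive_const.
  - unfold minus, plus, opp, zero, Cshare; simpl. ring. }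
set (V := fun t => Rmin (L t) 0 ^ 2 + Rmin (Rr t) 0 ^ 2 + Rmin (A t) 0 ^ 2 + Rmin (C t) 0 ^ 2).
set (dV := fun t =>
   2 * Rmin (L t) 0 * (aL * L t * C t + g * Rr t * C t + dL * A t * L t - mL * L t)
   + 2 * Rmin (Rr t) 0 * (aR * Rr t * C t + c * L t * C t + dR * A t * Rr t - mR * Rr t)
   + 2 * Rmin (A t) 0 * (- dL * A t * L t - dR * A t * Rr t - rh * A t)
   + 2 * Rmin (C t) 0 * (- (aL * L t + g * Rr t + aR * Rr t + c * L t) * C t
       + mL * L t + mR * Rr t + rh * A t)).
(* [dV] is twice a sum of nine terms, each at most [S * B] times [V]; [20] is a round number above
   18. *)
assert (HV : V T <= V 0 * exp ((20 * (S * B)) * T)).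
{ apply (gronwall V dV); auto.
  - intros t Ht; destruct (Hs t (proj1 Ht)) as (D1 & D2 & D3).
    repeat apply @is_derive_plus; apply is_derive_sqr_Rmin_comp; auto; apply dC; lra.
  - intros t Ht.
    specialize (BL' t Ht); specialize (BR' t Ht); specialize (BA' t Ht).
    assert (BC : Rabs (C t) <= B).
    { unfold C, Cshare, B; apply Rabs_le_between in BL'; apply Rabs_le_between in BR';
      apply Rabs_le_between in BA'; apply Rabs_le; lra. }
    assert (BL1 : Rabs (L t) <= B) by (unfold B; lra).
    assert (BR1 : Rabs (Rr t) <= B) by (unfold B; lra).
    assert (BA1 : Rabs (A t) <= B) by (unfold B; lra).
    assert (HB : 1 <= B) by (unfold B; lra).
    clearbody B. clear BL' BR' BA' HBL HBR HBA.
    unfold dV, V; clear dV V.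
    set (l := L t) in *; set (r := Rr t) in *; set (z := A t) in *; set (k := C t) in *.
    clearbody l r z k.
    pose proof (Rmin_0_mul3_le l r k B BR1 BC) as P1.
    pose proof (Rmin_0_mul3_le r l k B BL1 BC) as P2.
    pose proof (Rmin_0_mul_le k l) as P3.
    pose proof (Rmin_0_mul_le k r) as P4.
    pose proof (Rmin_0_mul_le k z) as P5.
    apply Rabs_le_between in BC; apply Rabs_le_between in BL1;
    apply Rabs_le_between in BR1; apply Rabs_le_between in BA1.
    assert (Q1 : aL * k + dL * z - mL <= S * B) by (unfold S; nra).
    assert (Q2 : aR * k + dR * z - mR <= S * B) by (unfold S; nra).
    assert (Q3 : - dL * l - dR * r - rh <= S * B) by (unfold S; nra).
    assert (Q4 : - (aL * l + g * r + aR * r + c * l) <= S * B) by (unfold S; nra).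
    apply (Rmin_0_sqr_mul_le l) in Q1; apply (Rmin_0_sqr_mul_le r) in Q2;
    apply (Rmin_0_sqr_mul_le z) in Q3; apply (Rmin_0_sqr_mul_le k) in Q4.
    set (nl := Rmin l 0) in *; set (nr := Rmin r 0) in *;
    set (nz := Rmin z 0) in *; set (nk := Rmin k 0) in *.
    set (W := nl ^ 2 + nr ^ 2 + nz ^ 2 + nk ^ 2).
    pose proof (pow2_ge_0 nl); pose proof (pow2_ge_0 nr);
    pose proof (pow2_ge_0 nz); pose proof (pow2_ge_0 nk).
    assert (HSB : 0 < S * B) by (apply Rmult_lt_0_compat; unfold S; lra).
    assert (T1 : g * (nl * (r * k)) <= S * B * W).
    { apply Rle_trans with (g * (B * W)).
      - apply Rmult_le_compat_l; [lra|]. apply Rle_trans with (1 := P1).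
        apply Rmult_le_compat_l; unfold W; lra.
      - rewrite <- Rmult_assoc; apply Rmult_le_compat_r; [unfold W; lra|].
        apply Rmult_le_compat_r; unfold S; lra. }
    assert (T2 : c * (nr * (l * k)) <= S * B * W).
    { apply Rle_trans with (c * (B * W)).
      - apply Rmult_le_compat_l; [lra|]. apply Rle_trans with (1 := P2).
        apply Rmult_le_compat_l; unfold W; lra.
      - rewrite <- Rmult_assoc; apply Rmult_le_compat_r; [unfold W; lra|].
        apply Rmult_le_compat_r; unfold S; lra. }
    assert (Lin : forall m s, 0 < m -> m <= S -> s <= W -> m * s <= S * B * W).
    { intros m s Hm HmS HsW. apply Rle_trans with (m * W); [apply Rmult_le_compat_l; lra|].
      apply Rmult_le_compat_r; [unfold W; lra|]. nra. }
    pose proof (Lin mL (nk * l) HmL ltac:(unfold S; lra) ltac:(unfold W; lra)).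
    pose proof (Lin mR (nk * r) HmR ltac:(unfold S; lra) ltac:(unfold W; lra)).
    pose proof (Lin rh (nk * z) Hrh ltac:(unfold S; lra) ltac:(unfold W; lra)).
    assert (Mono : forall s, s <= W -> S * B * s <= S * B * W).
    { intros; apply Rmult_le_compat_l; lra. }
    pose proof (Mono (nl ^ 2) ltac:(unfold W; lra)).
    pose proof (Mono (nr ^ 2) ltac:(unfold W; lra)).
    pose proof (Mono (nz ^ 2) ltac:(unfold W; lra)).
    pose proof (Mono (nk ^ 2) ltac:(unfold W; lra)).
    fold W. clear P1 P2 P3 P4 P5 Lin Mono BC BL1 BR1 BA1.
    replace (20 * (S * B) * W) with (20 * (S * B * W)) by ring.
    assert (0 <= S * B * W) by (apply Rmult_le_pos; unfold W; lra).
    set (SB := S * B) in *. clearbody SB. clear S. lra. }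
assert (V0 : V 0 = 0).
{ destruct H0 as (H1 & H2 & H3 & H4); unfold V.
  rewrite !Rmin_right; auto; [ring|unfold C, Cshare; lra]. }
rewrite V0, Rmult_0_l in HV; unfold V in HV.
pose proof (pow2_ge_0 (Rmin (L T) 0)); pose proof (pow2_ge_0 (Rmin (Rr T) 0));
pose proof (pow2_ge_0 (Rmin (A T) 0)); pose proof (pow2_ge_0 (Rmin (C T) 0)).
assert (N : forall x, Rmin x 0 ^ 2 <= 0 -> 0 <= x).
{ intros x Hx; unfold Rmin in Hx; destruct (Rle_dec x 0); nra. }
assert (0 <= C T) by (apply N; lra).
unfold C, Cshare in *.
repeat split; try (apply N; lra); lra.
Qed.

(** * The Perron root of [M^-1 K] *)

(** The other eigenvalue is [a + d - r], so maximality makes the sum of [r - a] and [r - d]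
    nonnegative. Their product [b * c] is positive, hence both are positive. *)
Lemma perron_root_dominates (a b c d r : R) :
  0 < b -> 0 < c -> is_perron_root2 a b c d r ->
  a < r /\ d < r /\ (r - a) * (r - d) = b * c.
Proof.
intros Hb Hc [He Hm]; unfold is_eigenvalue2 in *.
assert (E : (r - a) * (r - d) = b * c) by lra.
specialize (Hm (a + d - r) ltac:(lra)).
assert (0 < b * c) by (apply Rmult_lt_0_compat; auto).
destruct (Rlt_le_dec a r), (Rlt_le_dec d r); repeat split; auto; nra.
Qed.

(** Multiplication by [muL] and [muR] clears the denominators of [M^-1 K]; the last identity says
    that [l M - K] is singular. *)
Lemma Rrad_facts (p : params) (l : R) :
  params_pos p -> is_Rrad p l ->
  0 < l /\ 0 < l * muL p - alphaL p /\ 0 < l * muR p - alphaR p /\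
  (l * muL p - alphaL p) * (l * muR p - alphaR p) = gammaRL p * gammaLR p.
Proof.
destruct p as [aL aR mL mR g c dL dR rh]; unfold params_pos, is_Rrad; simpl.
intros (HaL & HaR & HmL & HmR & Hg & Hc & _) H.
apply perron_root_dominates in H; try (apply Rdiv_lt_0_compat; auto).
destruct H as (H1 & H2 & H3).
assert (Hl : 0 < l) by (pose proof (Rdiv_lt_0_compat _ _ HaL HmL); lra).
apply Rmult_lt_compat_r with (r := mL) in H1; auto.
apply Rmult_lt_compat_r with (r := mR) in H2; auto.
replace (aL / mL * mL) with aL in H1 by (field; lra).
replace (aR / mR * mR) with aR in H2 by (field; lra).
repeat split; try lra.
replace (l * mL - aL) with ((l - aL / mL) * mL) by (field; lra).
replace (l * mR - aR) with ((l - aR / mR) * mR) by (field; lra).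
transitivity ((l - aL / mL) * (l - aR / mR) * (mL * mR)); [ring|].
rewrite H3; field; lra.
Qed.

(** * Decay of [A], growth of [L + R], and the invariant axis *)

Lemma fA_le (p : params) (L Rr A : R) :
  params_pos p -> in_T L Rr A -> fA p L Rr A <= - rho p * A.
Proof.
destruct p as [aL aR mL mR g c dL dR rh]; unfold params_pos, fA, in_T; simpl.
intros (_ & _ & _ & _ & _ & _ & HdL & HdR & Hrh) (H1 & H2 & H3 & _).
assert (0 <= dL * A * L) by (repeat apply Rmult_le_pos; lra).
assert (0 <= dR * A * Rr) by (repeat apply Rmult_le_pos; lra).
lra.
Qed.

Lemma A_decay (p : params) (L Rr A : R -> R) :
  params_pos p -> is_solution p L Rr A -> in_T (L 0) (Rr 0) (A 0) ->
  forall t, 0 <= t -> A t <= A 0 * exp (- rho p * t).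
Proof.
intros Hp Hs H0 t Ht.
apply (gronwall A (fun s => fA p (L s) (Rr s) (A s))); auto.
- intros s Hst; apply Hs; lra.
- intros s Hst; apply fA_le; auto; apply (in_T_invariant p); auto; lra.
Qed.

Lemma A_lim (p : params) (L Rr A : R -> R) :
  params_pos p -> is_solution p L Rr A -> in_T (L 0) (Rr 0) (A 0) ->
  is_lim A p_infty 0.
Proof.
intros Hp Hs H0.
assert (Hr : 0 < rho p) by (unfold params_pos in Hp; tauto).
apply (is_lim_le_le_loc (fun _ => 0) (fun t => A 0 * exp (- rho p * t))).
- exists 0; intros t Ht; split.
  + apply (in_T_invariant p L Rr A Hp Hs H0 t); lra.
  + apply (A_decay p L Rr A Hp Hs H0 t); lra.
- apply is_lim_const.
- apply is_lim_scal_exp_neg; auto.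
Qed.

(** On the simplex the derivative of [L + Rr] is bounded in absolute value by [k * (L + Rr)]. The
    upper bound makes the axis invariant; the lower one keeps [L + Rr] positive off the axis. *)
Lemma N_growth (p : params) (L Rr A : R -> R) :
  params_pos p -> is_solution p L Rr A -> in_T (L 0) (Rr 0) (A 0) ->
  exists k, forall t, 0 <= t ->
    L t + Rr t <= (L 0 + Rr 0) * exp (k * t) /\
    (L 0 + Rr 0) * exp (- k * t) <= L t + Rr t.
Proof.
intros Hp Hs H0.
assert (HT := in_T_invariant p L Rr A Hp Hs H0).
exists (alphaL p + alphaR p + gammaRL p + gammaLR p + deltaL p + deltaR p + muL p + muR p).
destruct p as [aL aR mL mR g c dL dR rh]; unfold params_pos, is_solution, fL, fR, fA in *; simpl in *.
destruct Hp as (HaL & HaR & HmL & HmR & Hg & Hc & HdL & HdR & Hrh).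
set (k := aL + aR + g + c + dL + dR + mL + mR).
assert (I : forall t, 0 <= t ->
  - k * (L t + Rr t) <=
  (aL * L t * Cshare (L t) (Rr t) (A t) + g * Rr t * Cshare (L t) (Rr t) (A t)
     + dL * A t * L t - mL * L t) +
  (aR * Rr t * Cshare (L t) (Rr t) (A t) + c * L t * Cshare (L t) (Rr t) (A t)
     + dR * A t * Rr t - mR * Rr t) <= k * (L t + Rr t)).
{ intros t Ht; destruct (HT t Ht) as (H1 & H2 & H3 & H4).
  assert (H5 : 0 <= Cshare (L t) (Rr t) (A t) <= 1) by (unfold Cshare; lra).
  set (C := Cshare (L t) (Rr t) (A t)) in *; clearbody C.
  assert (B : forall q x y, 0 < q -> 0 <= x -> 0 <= y <= 1 -> 0 <= q * x * y <= q * x).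
  { intros q x y Hq Hx Hy; assert (0 <= q * x) by nra; nra. }
  pose proof (B aL (L t) C HaL H1 H5). pose proof (B g (Rr t) C Hg H2 H5).
  pose proof (B aR (Rr t) C HaR H2 H5). pose proof (B c (L t) C Hc H1 H5).
  pose proof (B dL (L t) (A t) HdL H1 ltac:(lra)).
  pose proof (B dR (Rr t) (A t) HdR H2 ltac:(lra)).
  unfold k.
  assert (Q : forall q, 0 < q -> 0 <= q * L t /\ 0 <= q * Rr t) by (intros; split; nra).
  pose proof (Q aL HaL); pose proof (Q aR HaR); pose proof (Q mL HmL);
  pose proof (Q mR HmR); pose proof (Q g Hg); pose proof (Q c Hc);
  pose proof (Q dL HdL); pose proof (Q dR HdR).
  lra. }
intros t Ht; split.
- apply (gronwall (fun t => L t + Rr t) _ k t Ht (fun s Hs' => is_derive_plus L Rr s _ _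
    (proj1 (Hs s (proj1 Hs'))) (proj1 (proj2 (Hs s (proj1 Hs')))))).
  intros s Hs'; apply I; lra.
(* The lower bound is Gronwall for the negated sum with rate [- k]. *)
- assert (- (L t + Rr t) <= - (L 0 + Rr 0) * exp (- k * t)); [|lra].
  apply (gronwall (fun t => - (L t + Rr t)) _ (- k) t Ht (fun s Hs' =>
    is_derive_opp (fun t => L t + Rr t) s _ (is_derive_plus L Rr s _ _
    (proj1 (Hs s (proj1 Hs'))) (proj1 (proj2 (Hs s (proj1 Hs'))))))).
  intros s Hs'; specialize (I s (proj1 Hs')); unfold opp, plus; simpl; lra.
Qed.

Lemma Gamma_invariant (p : params) (L Rr A : R -> R) :
  params_pos p -> is_solution p L Rr A -> in_Gamma (L 0) (Rr 0) (A 0) ->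
  forall t, 0 <= t -> in_Gamma (L t) (Rr t) (A t).
Proof.
intros Hp Hs (H0 & HL & HR) t Ht.
destruct (N_growth p L Rr A Hp Hs H0) as [k Hk].
destruct (Hk t Ht) as [H _]; rewrite HL, HR, Rplus_0_r, Rmult_0_l in H.
pose proof (in_T_invariant p L Rr A Hp Hs H0 t Ht) as HT.
split; auto; unfold in_T in HT; lra.
Qed.

Lemma Gamma_lim (p : params) (L Rr A : R -> R) :
  params_pos p -> is_solution p L Rr A -> in_Gamma (L 0) (Rr 0) (A 0) ->
  converges_to L Rr A 0 0 0.
Proof.
intros Hp Hs HG; pose proof (Gamma_invariant p L Rr A Hp Hs HG) as HI.
assert (Z : is_lim (fun _ => 0) p_infty 0) by apply is_lim_const.
split; [|split].
- apply (is_lim_ext_loc (fun _ => 0)); auto.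
  exists 0; intros t Ht; destruct (HI t) as (_ & E & _); lra.
- apply (is_lim_ext_loc (fun _ => 0)); auto.
  exists 0; intros t Ht; destruct (HI t) as (_ & _ & E); lra.
- apply (A_lim p L Rr A); auto; apply HG.
Qed.

(** * Global stability of the origin when the Perron root is at most one *)

(* [(gammaLR, l muL - alphaL)] is a left eigenvector: [w K = l w M].  Hence
   [w . (L, R)] has derivative [(l C - 1) w M (L, R)^T] up to terms in [A], which
   the exponential factor absorbs. *)
Lemma subcritical_lyapunov (p : params) (l : R) (L Rr A : R -> R) :
  params_pos p -> is_Rrad p l -> l <= 1 ->
  is_solution p L Rr A -> in_T (L 0) (Rr 0) (A 0) ->
  let Q t := (gammaLR p * L t + (l * muL p - alphaL p) * Rr t)
             * exp ((deltaL p + deltaR p) / rho p * A t) in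
  exists dQ k, 0 < k /\
    (forall t, 0 <= t -> is_derive Q t (dQ t)) /\
    (forall t, 0 <= t -> dQ t <= - k * Q t ^ 2).
Proof.
intros Hp HR Hl Hs H0 Q.
assert (HT := in_T_invariant p L Rr A Hp Hs H0).
assert (HA := fun t Ht => fA_le p (L t) (Rr t) (A t) Hp (HT t Ht)).
destruct (Rrad_facts p l Hp HR) as (Hl0 & Hu & Hv & Huv).
destruct p as [aL aR mL mR g c dL dR rh]; unfold params_pos in Hp; simpl in *.
destruct Hp as (HaL & HaR & HmL & HmR & Hg & Hc & HdL & HdR & Hrh).
remember (l * mL - aL) as u eqn:Eu. remember (l * mR - aR) as v eqn:Ev.
set (D := dL + dR) in *.
set (m := Rmin mL mR).
assert (Hm : 0 < m /\ m <= mL /\ m <= mR).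
{ unfold m; repeat split; [apply Rmin_glb_lt; auto|apply Rmin_l|apply Rmin_r]. }
set (p := Params aL aR mL mR g c dL dR rh) in *.
(* For [l <= 1], [l C - 1] is at most [- l (L + R)]. Here [L + R] is at least [P / (c + u)] and the
   weighted loss [W] below is at least [m P], which gives the rate [k0] on [P ^ 2]. *)
set (k0 := l * m / (c + u)).
assert (Hk0 : 0 < k0) by (apply Rdiv_lt_0_compat; nra).
set (dP := fun t => c * fL p (L t) (Rr t) (A t) + u * fR p (L t) (Rr t) (A t)).
set (P := fun t => c * L t + u * Rr t).
assert (HP0 : forall t, 0 <= t -> 0 <= P t).
{ intros t Ht; destruct (HT t Ht) as (H1 & H2 & _); unfold P; nra. }
exists (fun t => dP t * exp (D / rh * A t)
   + P t * (D / rh * fA p (L t) (Rr t) (A t) * exp (D / rh * A t))),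
  (k0 * exp (- (D / rh))).
split; [|split].
- pose proof (exp_pos (- (D / rh))); nra.
- intros t Ht; destruct (Hs t Ht) as (D1 & D2 & D3).
  apply (is_derive_mult P (fun t => exp (D / rh * A t))).
  + unfold P, dP; apply @is_derive_plus; apply is_derive_scal; auto.
  + apply (is_derive_comp exp (fun t => D / rh * A t)); [apply is_derive_exp|].
    apply is_derive_scal; auto.
  + intros; apply Rmult_comm.
- intros t Ht; destruct (HT t Ht) as (H1 & H2 & H3 & H4).
  set (E := exp (D / rh * A t)); assert (HE : 0 < E) by apply exp_pos.
  assert (KP : dP t <= - k0 * P t ^ 2 + D * A t * P t).
  { unfold dP, fL, fR, P, Cshare; simpl.
    set (W := c * mL * L t + u * mR * Rr t).
    replace (c * (aL * L t * (1 - L t - Rr t - A t) + g * Rr t * (1 - L t - Rr t - A t)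
       + dL * A t * L t - mL * L t) +
     u * (aR * Rr t * (1 - L t - Rr t - A t) + c * L t * (1 - L t - Rr t - A t)
       + dR * A t * Rr t - mR * Rr t))
    with ((l * (1 - L t - Rr t - A t) - 1) * W + A t * (c * dL * L t + u * dR * Rr t)).
    2:{ unfold W. replace aR with (l * mR - v) by lra.
        replace (c * (aL * L t * (1 - L t - Rr t - A t) + g * Rr t * (1 - L t - Rr t - A t)
         + dL * A t * L t - mL * L t))
        with (c * (aL * L t * (1 - L t - Rr t - A t) + dL * A t * L t - mL * L t)
          + (g * c) * Rr t * (1 - L t - Rr t - A t)) by ring.
        rewrite <- Huv; replace aL with (l * mL - u) by lra; ring. }
    assert (HcL : 0 <= c * L t) by nra. assert (HuR : 0 <= u * Rr t) by nra.
    assert (I1 : A t * (c * dL * L t + u * dR * Rr t) <= D * A t * (c * L t + u * Rr t)).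
    { unfold D. assert (0 <= A t * (c * L t)) by nra. assert (0 <= A t * (u * Rr t)) by nra.
      nra. }
    assert (HW : m * (c * L t + u * Rr t) <= W) by (unfold W; nra).
    assert (HN : (c * L t + u * Rr t) / (c + u) <= L t + Rr t).
    { apply Rmult_le_reg_r with (c + u); [lra|].
      replace ((c * L t + u * Rr t) / (c + u) * (c + u)) with (c * L t + u * Rr t)
        by (field; lra). nra. }
    set (PP := c * L t + u * Rr t) in *.
    assert (HPP : 0 <= PP) by (unfold PP; lra).
    assert (I2 : l * (m * (PP / (c + u) * PP)) <= l * ((L t + Rr t) * W)).
    { apply Rmult_le_compat_l; [lra|].
      replace (m * (PP / (c + u) * PP)) with (PP / (c + u) * (m * PP)) by ring.
      apply Rmult_le_compat; auto; [|nra].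
      apply Rle_mult_inv_pos; lra. }
    replace (- k0 * (PP * (PP * 1))) with (- (l * (m * (PP / (c + u) * PP))))
      by (unfold k0; field; lra).
    assert (0 <= W) by nra.
    assert (0 <= l * A t) by nra.
    assert (0 <= (l * A t) * W) by nra.
    assert (0 <= (1 - l) * W) by nra.
    lra. }
  specialize (HA t Ht); specialize (HP0 t Ht).
  change (Q t) with (P t * E).
  assert (HAt : A t <= 1) by lra.
  (* The exponent falls at rate at least [D * A t], which cancels the [A] term of [KP]. *)
  assert (J1 : D / rh * fA p (L t) (Rr t) (A t) <= - D * A t).
  { replace (- D * A t) with (D / rh * (- rh * A t)) by (field; lra).
    apply Rmult_le_compat_l; [apply Rle_mult_inv_pos; unfold D; lra|auto]. }
  (* As [A t <= 1], this turns the bound in [P t ^ 2 * E] into one in the square of [Q t]. *)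
  assert (J2 : exp (- (D / rh)) * E <= 1).
  { unfold E; rewrite <- exp_plus, <- exp_0.
    assert (0 < D / rh) by (apply Rdiv_lt_0_compat; unfold D; lra).
    destruct (Req_dec (A t) 1) as [e|e].
    - right; f_equal; rewrite e; ring.
    - left; apply exp_increasing; nra. }
  apply Rle_trans with (- k0 * P t ^ 2 * E).
  + replace (dP t * E + P t * (D / rh * fA p (L t) (Rr t) (A t) * E))
      with ((dP t + P t * (D / rh * fA p (L t) (Rr t) (A t))) * E) by ring.
    apply Rmult_le_compat_r; [lra|]. nra.
  + replace (- (k0 * exp (- (D / rh))) * (P t * E) ^ 2)
      with (- k0 * P t ^ 2 * E * (exp (- (D / rh)) * E)) by ring.
    assert (0 <= k0 * P t ^ 2 * E) by (pose proof (pow2_ge_0 (P t)); apply Rmult_le_pos; nra).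
    nra.
Qed.

Lemma dist3_0_le_sum (x y z : R) :
  0 <= x -> 0 <= y -> 0 <= z -> dist3 x y z 0 0 0 <= x + y + z.
Proof.
intros Hx Hy Hz; unfold dist3.
rewrite <- (sqrt_pow2 (x + y + z)) by lra.
apply sqrt_le_1_alt; nra.
Qed.

Lemma abs_le_dist3_0 (x y z : R) :
  Rabs x <= dist3 x y z 0 0 0 /\ Rabs y <= dist3 x y z 0 0 0 /\ Rabs z <= dist3 x y z 0 0 0.
Proof.
unfold dist3; rewrite <- !sqrt_Rsqr_abs; unfold Rsqr.
repeat split; apply sqrt_le_1_alt; nra.
Qed.

(** Monotonicity of the Lyapunov function [Q] and of the bound on [A] gives stability; the quadratic
    inequality for [Q] gives [Q ^ 2 = O(1 / t)], hence attraction, also at [l = 1]. *)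
Lemma subcritical_GAS (p : params) (l : R) :
  params_pos p -> is_Rrad p l -> l <= 1 -> GAS_on_T p 0 0 0.
Proof.
intros Hp HR Hl.
destruct (Rrad_facts p l Hp HR) as (Hl0 & Hu & _).
pose proof (fun L Rr A => subcritical_lyapunov p l L Rr A Hp HR Hl) as HQ.
pose proof (fun L Rr A => in_T_invariant p L Rr A Hp) as HI.
pose proof (fun L Rr A => A_decay p L Rr A Hp) as HD.
pose proof (fun L Rr A => A_lim p L Rr A Hp) as HAl.
set (u := l * muL p - alphaL p) in *.
destruct Hp as (HaL & HaR & HmL & HmR & Hg & Hc & HdL & HdR & Hrh).
set (c := gammaLR p) in *. set (rh := rho p) in *.
set (d := (deltaL p + deltaR p) / rh) in *.
assert (Hd : 0 < d) by (apply Rdiv_lt_0_compat; lra).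
clearbody u c d rh.
assert (HPQ : forall L Rr A, in_T L Rr A ->
  c * L + u * Rr <= (c * L + u * Rr) * exp (d * A)).
{ intros L Rr A (H1 & H2 & H3 & _).
  assert (0 <= c * L + u * Rr) by nra.
  assert (1 + d * A <= exp (d * A)) by (apply exp_ineq1_le).
  assert (0 <= d * A) by nra. nra. }
split.
- intros eps He.
  (* The terms in [/ c] and [/ u] bound [L] and [Rr] through [c L + u R], [exp d] bounds the initial
     exponential factor, and the final [1] accounts for [A]. *)
  set (K := (c + u) * exp d * (/ c + / u) + 1).
  assert (HK : 0 < K).
  { unfold K; pose proof (exp_pos d); pose proof (Rinv_0_lt_compat c Hc);
    pose proof (Rinv_0_lt_compat u Hu).
    assert (0 < (c + u) * exp d * (/ c + / u)) by (repeat apply Rmult_lt_0_compat; lra).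
    lra. }
  exists (eps / K); split; [apply Rdiv_lt_0_compat; auto|].
  intros L Rr A Hs H0 Hdist t Ht.
  destruct (HQ L Rr A Hs H0) as (dQ & k & Hk & DQ & IQ).
  assert (HT := HI L Rr A Hs H0 t Ht).
  set (e := dist3 (L 0) (Rr 0) (A 0) 0 0 0) in *.
  destruct (abs_le_dist3_0 (L 0) (Rr 0) (A 0)) as (B1 & B2 & B3). fold e in B1, B2, B3.
  pose proof H0 as (H1 & H2 & H3 & H4). destruct HT as (T1 & T2 & T3 & T4).
  rewrite Rabs_pos_eq in B1, B2, B3 by auto.
  apply Rle_lt_trans with (1 := dist3_0_le_sum _ _ _ T1 T2 T3).
  apply Rle_lt_trans with (K * e).
  + assert (IP : c * L t + u * Rr t <= (c + u) * e * exp d).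
    { apply Rle_trans with (1 := HPQ _ _ _ (HI L Rr A Hs H0 t Ht)).
      apply Rle_trans with ((c * L 0 + u * Rr 0) * exp (d * A 0)).
      - apply (derive_nonpos_decr
          (fun t => (c * L t + u * Rr t) * exp (d * A t)) dQ 0 t Ht).
        + intros; apply DQ; lra.
        + intros s Hst; apply Rle_trans with (1 := IQ s ltac:(lra)).
          match goal with |- - k * ?x ^ 2 <= 0 => pose proof (pow2_ge_0 x) end. nra.
      - assert (0 <= c * L 0) by nra. assert (0 <= u * Rr 0) by nra.
        apply Rmult_le_compat; try lra; [left; apply exp_pos|nra|].
        destruct (Req_dec (A 0) 1) as [E|E].
        + right; f_equal; rewrite E; ring.
        + left; apply exp_increasing; nra. }
    assert (IL : L t <= (c + u) * e * exp d * / c).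
    { apply Rmult_le_reg_r with c; auto. rewrite Rmult_assoc, Rinv_l, Rmult_1_r by lra. nra. }
    assert (IR : Rr t <= (c + u) * e * exp d * / u).
    { apply Rmult_le_reg_r with u; auto. rewrite Rmult_assoc, Rinv_l, Rmult_1_r by lra. nra. }
    assert (IA : A t <= e).
    { apply Rle_trans with (2 := B3), Rle_trans with (1 := HD L Rr A Hs H0 t Ht).
      rewrite <- (Rmult_1_r (A 0)) at 2; apply Rmult_le_compat_l; auto.
      destruct (Req_dec t 0) as [E|E].
      - right; rewrite E, Rmult_0_r; apply exp_0.
      - left; rewrite <- exp_0; apply exp_increasing; nra. }
    unfold K; lra.
  + apply Rmult_lt_compat_r with (r := K) in Hdist; auto.
    replace (eps / K * K) with eps in Hdist by (field; lra). lra.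
- intros L Rr A Hs H0.
  destruct (HQ L Rr A Hs H0) as (dQ & k & Hk & DQ & IQ).
  set (Q := fun t => (c * L t + u * Rr t) * exp (d * A t)) in *.
  assert (HQP : forall t, 0 <= t -> 0 <= c * L t + u * Rr t <= Q t).
  { intros t Ht; split; [|apply HPQ; auto].
    destruct (HI L Rr A Hs H0 t Ht) as (H1 & H2 & _); nra. }
  assert (HQ2 := decay_of_quadratic_ineq Q dQ k Hk
    (fun t Ht => Rle_trans _ _ _ (proj1 (HQP t Ht)) (proj2 (HQP t Ht))) DQ IQ).
  assert (Lim : forall (f : R -> R) (w : R), 0 < w ->
    (forall t, 0 <= t -> 0 <= w * f t <= Q t) -> is_lim f p_infty 0).
  { intros f w Hw Hf.
    apply is_lim_of_sqr with (fun t => Q 0 / k / w ^ 2 * / t); [|apply is_lim_scal_inv].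
    intros t Ht. specialize (HQ2 t Ht). specialize (Hf t ltac:(lra)).
    apply Rmult_le_reg_r with (w ^ 2); [apply pow_lt; auto|].
    replace (Q 0 / k / w ^ 2 * / t * w ^ 2) with (Q 0 / k * / t) by (field; lra).
    apply Rle_trans with (2 := HQ2). rewrite Rminus_0_r.
    replace (f t ^ 2 * w ^ 2) with ((w * f t) ^ 2) by ring.
    apply pow_incr; auto. }
  split; [|split].
  + apply (Lim L c Hc); intros t Ht; specialize (HQP t Ht).
    destruct (HI L Rr A Hs H0 t Ht) as (H1 & H2 & _); nra.
  + apply (Lim Rr u Hu); intros t Ht; specialize (HQP t Ht).
    destruct (HI L Rr A Hs H0 t Ht) as (H1 & H2 & _); nra.
  + apply (HAl L Rr A); auto.
Qed.

(** * The coexistence equilibrium: existence and uniqueness *)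

(** With [A = 0], take [C = / l] and [(L, R)] along the right Perron eigenvector [(gammaRL, u)];
    [ths] is its normalized first entry and [Ns = 1 - C] fixes the length. *)
Lemma endemic_equilibrium (p : params) (l : R) :
  params_pos p -> is_Rrad p l -> 1 < l ->
  let u := l * muL p - alphaL p in
  let ths := gammaRL p / (gammaRL p + u) in
  let Ns := 1 - / l in
  0 < ths < 1 /\ 0 < Ns < 1 /\ is_equilibrium p (ths * Ns) ((1 - ths) * Ns) 0.
Proof.
intros Hp HR Hl u ths Ns.
destruct (Rrad_facts p l Hp HR) as (Hl0 & Hu & Hv & Huv).
assert (Hths : 0 < ths < 1).
{ unfold params_pos in Hp; fold u in Hu; unfold ths; split.
  - apply Rdiv_lt_0_compat; lra.
  - apply Rmult_lt_reg_r with (gammaRL p + u); [lra|].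
    replace (gammaRL p / (gammaRL p + u) * (gammaRL p + u)) with (gammaRL p) by (field; lra).
    lra. }
assert (HNs : 0 < Ns < 1).
{ unfold Ns; pose proof (Rinv_0_lt_compat l Hl0).
  assert (/ l < 1) by (rewrite <- Rinv_1; apply Rinv_lt_contravar; lra). lra. }
split; [|split]; auto.
destruct p as [aL aR mL mR g c dL dR rh]; unfold params_pos in Hp; simpl in *.
destruct Hp as (HaL & HaR & HmL & HmR & Hg & Hc & HdL & HdR & Hrh).
unfold is_equilibrium, fL, fR, fA, Cshare; simpl.
replace (1 - ths * Ns - (1 - ths) * Ns - 0) with (/ l) by (unfold Ns; ring).
assert (Ec : c = u * (l * mR - aR) / g) by (unfold u; rewrite Huv; field; lra).
fold u in Hu. rewrite Ec.
replace aL with (l * mL - u) by (unfold u; ring).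
unfold ths; clearbody u Ns.
repeat split; field; lra.
Qed.

(** The third equation factors and forces [A = 0]. Then [(L, R)] is a positive eigenvector of
    [M^-1 K] for [/ C], which must be the Perron root; this fixes both the ratio and the sum of [L]
    and [R]. *)
Lemma endemic_equilibrium_unique (p : params) (l L Rr A : R) :
  params_pos p -> is_Rrad p l -> 0 < L -> 0 < Rr -> in_T L Rr A ->
  is_equilibrium p L Rr A ->
  let ths := gammaRL p / (gammaRL p + (l * muL p - alphaL p)) in
  L = ths * (1 - / l) /\ Rr = (1 - ths) * (1 - / l) /\ A = 0.
Proof.
intros Hp HR HL HRr HT He ths.
destruct (Rrad_facts p l Hp HR) as (Hl0 & Hu & Hv & Huv).
unfold ths; clear ths.
destruct p as [aL aR mL mR g c dL dR rh]; unfold params_pos in Hp; simpl in *.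
destruct Hp as (HaL & HaR & HmL & HmR & Hg & Hc & HdL & HdR & Hrh).
unfold is_equilibrium, fL, fR, fA, Cshare in He; simpl in He.
destruct He as (E1 & E2 & E3).
assert (HA : A = 0).
{ assert (0 < dL * L + dR * Rr + rh) by nra.
  assert (A * (dL * L + dR * Rr + rh) = 0) by lra.
  apply Rmult_integral in H0; lra. }
subst A; rewrite Rminus_0_r in E1, E2.
set (C := 1 - L - Rr) in *.
assert (F1 : C * (aL * L + g * Rr) = mL * L) by lra.
assert (F2 : C * (aR * Rr + c * L) = mR * Rr) by lra.
assert (HmLL : 0 < mL * L) by nra.
assert (HaLL : 0 < aL * L + g * Rr) by nra.
assert (HC : 0 < C) by nra.
(* [/ C] and [l] both dominate the diagonal of [M^-1 K], and only one eigenvalue does. *)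
assert (G1 : (mL - C * aL) * L = C * g * Rr) by lra.
assert (G2 : (mR - C * aR) * Rr = C * c * L) by lra.
assert (HgR : 0 < C * g * Rr) by (repeat apply Rmult_lt_0_compat; auto).
assert (HcL : 0 < C * c * L) by (repeat apply Rmult_lt_0_compat; auto).
assert (P1 : 0 < mL - C * aL) by nra.
assert (P2 : 0 < mR - C * aR) by nra.
assert (G : (mL - C * aL) * (mR - C * aR) = C ^ 2 * (g * c)).
{ apply Rmult_eq_reg_r with (L * Rr); [|nra].
  transitivity (((mL - C * aL) * L) * ((mR - C * aR) * Rr)); [ring|].
  rewrite G1, G2; ring. }
assert (Hlc : l * C = 1).
{ assert (F : (mL - C * aL) * (mR - C * aR)
     = (C * (l * mL - aL)) * (C * (l * mR - aR))).
  { rewrite G, <- Huv; ring. }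
  assert (Q1 : 0 < C * (l * mL - aL)) by nra.
  assert (Q2 : 0 < C * (l * mR - aR)) by nra.
  assert (D1 : mL - C * aL = C * (l * mL - aL) + (1 - l * C) * mL) by ring.
  assert (D2 : mR - C * aR = C * (l * mR - aR) + (1 - l * C) * mR) by ring.
  (* If [l * C] differs from [1], both positive factors in [F] shift in the same direction, so the
     products cannot agree. *)
  destruct (Rtotal_order (l * C) 1) as [H|[H|H]]; auto; exfalso.
  - assert (C * (l * mL - aL) < mL - C * aL) by nra.
    assert (C * (l * mR - aR) < mR - C * aR) by nra. nra.
  - assert (mL - C * aL < C * (l * mL - aL)) by nra.
    assert (mR - C * aR < C * (l * mR - aR)) by nra. nra. }
assert (EC : C = / l) by (apply Rmult_eq_reg_l with l; [rewrite Hlc; field|]; lra).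
assert (EN : L + Rr = 1 - / l) by (rewrite <- EC; unfold C; ring).
assert (Eq : (l * mL - aL) * L = g * Rr).
{ transitivity (l * ((mL - C * aL) * L) + (l * C - 1) * aL * L); [ring|].
  rewrite G1, Hlc. transitivity (l * C * (g * Rr)); [ring|]. rewrite Hlc; ring. }
rewrite <- EN.
repeat split; auto.
- apply Rmult_eq_reg_r with (g + (l * mL - aL)); [|lra].
  transitivity (g * L + (l * mL - aL) * L); [ring|]. rewrite Eq; field; lra.
- apply Rmult_eq_reg_r with (g + (l * mL - aL)); [|lra].
  transitivity ((l * mL - aL) * Rr + g * Rr); [ring|]. rewrite <- Eq at 1; field; lra.
Qed.

(** * Convergence off the axis when the Perron root exceeds one *)

(* With [N = L + R], [x = L / N] and [C = 1 - N - A], the system reads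
   [N' = N (C total_growth x - total_decay x + A (deltaL x + deltaR (1 - x)))] and
   [x' = C share_drift x - ((muL - muR) - A (deltaL - deltaR)) x (1 - x)]. *)
Definition total_growth (p : params) (x : R) : R :=
  (alphaL p + gammaLR p) * x + (alphaR p + gammaRL p) * (1 - x).
Definition total_decay (p : params) (x : R) : R := muL p * x + muR p * (1 - x).
Definition share_drift (p : params) (x : R) : R :=
  gammaRL p * (1 - x) ^ 2 + (alphaL p - alphaR p) * x * (1 - x) - gammaLR p * x ^ 2.

(** The factored expressions are [- x'] and [N' / N] at [A = 0], [C = / l]. Both are polynomials in
    [x] that vanish at the equilibrium share [ths], so [x - ths] divides them. *)
Lemma supercritical_factorization (p : params) (l : R) :
  params_pos p -> is_Rrad p l ->
  let ths := gammaRL p / (gammaRL p + (l * muL p - alphaL p)) in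
  exists (Phi : R -> R) (eps : R),
    (forall x, continuous Phi x) /\
    (forall x, 0 <= x <= 1 -> 0 < Phi x) /\
    (forall x, 0 <= x <= 1 ->
       0 < total_growth p x * Phi x + eps * share_drift p x) /\
    (forall x, (muL p - muR p) * x * (1 - x) - / l * share_drift p x = Phi x * (x - ths)) /\
    (forall x, / l * total_growth p x - total_decay p x = eps * (x - ths)).
Proof.
intros Hp HR ths; unfold ths; clear ths.
destruct (Rrad_facts p l Hp HR) as (Hl0 & Hu & Hv & Huv).
unfold total_growth, total_decay, share_drift.
destruct p as [aL aR mL mR g c dL dR rh]; unfold params_pos in Hp; simpl in *.
destruct Hp as (HaL & HaR & HmL & HmR & Hg & Hc & HdL & HdR & Hrh).
remember (l * mL - aL) as u eqn:Eu. remember (l * mR - aR) as v eqn:Ev.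
assert (EaL : aL = l * mL - u) by lra.
assert (EaR : aR = l * mR - v) by lra.
(* Eliminating [c], [aL] and [aR] through [u] and [v] builds the singularity of [l M - K] into the
   formulas, so the identities below are rational. *)
assert (Ec : c = u * v / g) by (rewrite Huv; field; lra).
clear HR Eu Ev HaL HaR Hc Huv; subst aL aR c.
assert (Hug : 0 < 1 + u / g) by (pose proof (Rdiv_lt_0_compat u g Hu Hg); lra).
assert (Hmix : forall r s x, 0 < r -> 0 < s -> 0 <= x <= 1 -> 0 < r * (1 - x) + s * x).
{ intros r s x Hr Hs Hx; destruct (Req_dec x 0) as [->|]; nra. }
exists (fun x => / l * (1 + u / g) * (g * (1 - x) + v * x)),
  ((u * v / g - u - g + v) / l).
split; [|split; [|split; [|split]]].
- intros x; apply continuity_pt_filterlim; reg.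
- intros x Hx; pose proof (Rinv_0_lt_compat l Hl0).
  repeat apply Rmult_lt_0_compat; auto.
- intros x Hx.
  (* The quadratic terms cancel, leaving an affine function that is positive at both ends of
     [[0, 1]]. *)
  match goal with |- 0 < ?e =>
    replace e with ((1 + u / g) * (mR * g * (1 - x) + mL * v * x)) by (field; lra) end.
  apply Rmult_lt_0_compat; auto; apply Hmix; auto; apply Rmult_lt_0_compat; auto.
- intros x; field; lra.
- intros x; field; lra.
Qed.

Lemma antiderivative_centered (G : R -> R) (x0 : R) :
  (forall x, continuous G x) ->
  exists H : R -> R, H x0 = 0 /\ forall x, is_derive H x (G x * (x - x0)).
Proof.
intros HG.
set (f := fun x => G x * (x - x0)).
assert (Hf : forall x, continuous f x).
{ intros x; apply (continuous_mult G (fun x => x - x0)); auto.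
  apply continuity_pt_filterlim; reg. }
exists (RInt f x0); split; [exact (RInt_point x0 f)|].
intros x; apply (is_derive_RInt f (RInt f x0) x0 x); auto.
apply filter_forall; intros y; apply @RInt_correct.
apply (@ex_RInt_continuous R_CompleteNormedModule); auto.
Qed.

(** Off the axis [N] stays positive, so the share [th] is defined for all time. Monotonicity of [U]
    first bounds [N] away from [0]; on that range [V] is comparable with [X ^ 2 + Y ^ 2], which
    yields [dU <= - k * U]. *)
Lemma supercritical_lim (p : params) (l : R) (L Rr A : R -> R) :
  params_pos p -> is_Rrad p l -> 1 < l ->
  is_solution p L Rr A -> in_T (L 0) (Rr 0) (A 0) -> ~ in_Gamma (L 0) (Rr 0) (A 0) ->
  let ths := gammaRL p / (gammaRL p + (l * muL p - alphaL p)) in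
  let Ns := 1 - / l in
  converges_to L Rr A (ths * Ns) ((1 - ths) * Ns) 0.
Proof.
intros Hp HR Hl Hs H0 HnG ths Ns.
assert (HT := in_T_invariant p L Rr A Hp Hs H0).
assert (HAl := A_lim p L Rr A Hp Hs H0).
assert (HfA := fun t Ht => fA_le p (L t) (Rr t) (A t) Hp (HT t Ht)).
destruct (endemic_equilibrium p l Hp HR Hl) as (Hths & HNs & _); fold ths in Hths; fold Ns in HNs.
destruct (supercritical_factorization p l Hp HR) as (Phi & eps & CPhi & PPhi & Ppsi & Ephi & Ee).
fold ths in Ephi, Ee.
set (N := fun t => L t + Rr t). set (th := fun t => L t / N t).
assert (HN : forall t, 0 <= t -> 0 < N t <= 1).
{ intros t Ht; destruct (HT t Ht) as (T1 & T2 & T3 & T4); split; [|unfold N; lra].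
  destruct (N_growth p L Rr A Hp Hs H0) as [k Hk].
  apply Rlt_le_trans with (2 := proj2 (Hk t Ht)).
  apply Rmult_lt_0_compat; [|apply exp_pos].
  destruct (Rlt_le_dec 0 (L 0 + Rr 0)) as [|Hz]; auto.
  exfalso; apply HnG; pose proof H0 as (Z1 & Z2 & _); split; [auto|split; lra]. }
assert (Hth : forall t, 0 <= t -> 0 <= th t <= 1).
{ intros t Ht; destruct (HT t Ht) as (T1 & T2 & _); destruct (HN t Ht) as [N1 _].
  unfold th; split; [apply Rle_mult_inv_pos; auto|].
  apply Rmult_le_reg_r with (N t); auto.
  replace (L t / N t * N t) with (L t) by (field; lra). unfold N; lra. }
set (a := total_growth p) in *. set (b := share_drift p) in *.
assert (Pa : forall x, 0 <= x <= 1 -> 0 < a x).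
{ intros x Hx; unfold params_pos in Hp; unfold a, total_growth.
  destruct (Req_dec x 0) as [->|]; nra. }
destruct (lyapunov_weight a b Phi eps) as (G & c0 & g1 & g2 & Hc0 & Hg1 & Hg2 & CG & BG & HG); auto.
{ intros x; apply continuity_pt_filterlim; unfold a, total_growth; reg. }
{ intros x; apply continuity_pt_filterlim; unfold b, share_drift; reg. }
destruct (antiderivative_centered G ths CG) as (H & HH0 & HHd).
set (d := fun x => deltaL p * x + deltaR p * (1 - x)).
set (s := fun x => (deltaL p - deltaR p) * x * (1 - x)).
set (X := fun t => N t - Ns). set (Y := fun t => th t - ths).
(* Both right-hand sides come from substituting [C = / l - X - A] and the two factorizations. *)
set (dN := fun t => N t * (- a (th t) * X t + eps * Y t + A t * (d (th t) - a (th t)))).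
set (dth := fun t => - Phi (th t) * Y t - b (th t) * X t + A t * (s (th t) - b (th t))).
assert (DN : forall t, 0 <= t -> is_derive N t (dN t)).
{ intros t Ht; destruct (Hs t Ht) as (D1 & D2 & _); destruct (HN t Ht) as [N1 _].
  evar_last; [apply (is_derive_plus L Rr t); eassumption|].
  unfold dN, Y; rewrite <- Ee; unfold X, Ns, a, d, total_growth, total_decay, fL, fR, Cshare.
  unfold th, plus; simpl; unfold N in *; field; split; lra. }
assert (Dth : forall t, 0 <= t -> is_derive th t (dth t)).
{ intros t Ht; destruct (Hs t Ht) as (D1 & D2 & _); destruct (HN t Ht) as [N1 _].
  evar_last; [apply (is_derive_div L N t); [eassumption|apply (is_derive_plus L Rr t); eassumption|lra]|].
  unfold dth, Y.
  replace (- Phi (th t) * (th t - ths)) with (- (Phi (th t) * (th t - ths))) by ring.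
  rewrite <- Ephi; unfold X, Ns, b, s, share_drift, fL, fR, Cshare.
  unfold th, plus; simpl; unfold N in *; field; split; lra. }
(* A Volterra function: the denominator of its derivative [(x - Ns) / x] cancels the factor [N] of
   [dN]. *)
set (V1 := fun x => x - Ns - Ns * (ln x - ln Ns)).
assert (DV1 : forall x, 0 < x -> is_derive V1 x (/ x * (x - Ns))).
{ intros x Hx; unfold V1; auto_derive; auto; field; lra. }
assert (V1s : V1 Ns = 0) by (unfold V1; ring).
set (S := deltaL p + deltaR p + alphaL p + alphaR p + gammaRL p + gammaLR p).
assert (BdA : forall x, 0 <= x <= 1 -> Rabs (d x - a x) <= S /\ Rabs (s x - b x) <= S).
{ intros x Hx; unfold params_pos in Hp.
  assert (M : forall q y, 0 < q -> 0 <= y <= 1 -> 0 <= q * y <= q) by (intros; split; nra).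
  assert (Z1 : 0 <= x * (1 - x) <= 1) by nra.
  assert (Z2 : 0 <= (1 - x) ^ 2 <= 1) by nra.
  assert (Z3 : 0 <= x ^ 2 <= 1) by nra.
  assert (Z4 : 0 <= 1 - x <= 1) by lra.
  unfold d, a, s, b, total_growth, share_drift, S.
  destruct Hp as (HaL & HaR & HmL & HmR & Hg & Hc & HdL & HdR & Hrh).
  pose proof (M _ _ HdL Hx). pose proof (M _ _ HdR Z4).
  pose proof (M _ _ HaL Hx). pose proof (M _ _ HaR Z4).
  pose proof (M _ _ Hc Hx). pose proof (M _ _ Hg Z4).
  pose proof (M _ _ HdL Z1). pose proof (M _ _ HdR Z1).
  pose proof (M _ _ HaL Z1). pose proof (M _ _ HaR Z1).
  pose proof (M _ _ Hc Z3). pose proof (M _ _ Hg Z2).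
  split; apply Rabs_le; lra. }
assert (HS : 0 < S) by (unfold params_pos in Hp; unfold S; lra).
(* Bounds the coefficient of [A] in [dV], since [X] and [Y] are at most [1] in absolute value and
   [G <= g2]. *)
set (K := (1 + g2) * S).
assert (HK : 0 < K) by (unfold K; apply Rmult_lt_0_compat; lra).
assert (Hr : 0 < rho p) by (unfold params_pos in Hp; tauto).
set (V := fun t => V1 (N t) + H (th t)).
set (dV := fun t => dN t * (/ N t * X t) + dth t * (G (th t) * Y t)).
assert (DV : forall t, 0 <= t -> is_derive V t (dV t)).
{ intros t Ht; apply @is_derive_plus.
  - apply (is_derive_comp V1 N); [apply DV1, HN, Ht|auto].
  - apply (is_derive_comp H th); auto. }
set (W := fun t => X t ^ 2 + Y t ^ 2).
assert (HW : forall t, 0 <= W t).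
{ intros t; unfold W; pose proof (pow2_ge_0 (X t)); pose proof (pow2_ge_0 (Y t)); lra. }
assert (IV : forall t, 0 <= t -> dV t <= - c0 * W t + K * A t).
{ intros t Ht; destruct (HN t Ht) as [N1 N2]; pose proof (Hth t Ht) as T.
  destruct (HT t Ht) as (_ & _ & A1 & _).
  destruct (BdA _ T) as [B1 B2]. destruct (BG (th t)) as [G1 G2].
  assert (BX : Rabs (X t) <= 1) by (apply Rabs_le; unfold X; lra).
  assert (BY : Rabs (Y t) <= 1) by (apply Rabs_le; unfold Y; lra).
  specialize (HG (th t) (X t) (Y t) T).
  replace (dV t) with
   ((- a (th t) * X t ^ 2 + (eps - G (th t) * b (th t)) * X t * Y t
      - G (th t) * Phi (th t) * Y t ^ 2)
    + A t * (X t * (d (th t) - a (th t)) + G (th t) * (Y t * (s (th t) - b (th t)))))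
   by (unfold dV, dN, dth; field; lra).
  assert (M : forall x y, Rabs x <= 1 -> Rabs y <= S -> x * y <= S).
  { intros x y Hx Hy; apply Rle_trans with (1 := Rle_abs _); rewrite Rabs_mult.
    pose proof (Rabs_pos x); pose proof (Rabs_pos y); nra. }
  pose proof (M _ _ BX B1). pose proof (M _ _ BY B2).
  assert (G (th t) * (Y t * (s (th t) - b (th t))) <= g2 * S).
  { apply Rle_trans with (G (th t) * S); [apply Rmult_le_compat_l; lra|].
    apply Rmult_le_compat_r; lra. }
  assert (A t * (X t * (d (th t) - a (th t)) + G (th t) * (Y t * (s (th t) - b (th t))))
     <= A t * K) by (apply Rmult_le_compat_l; auto; unfold K; lra).
  unfold W; lra. }
(* The added term contributes at most [- 2 * K * A]: one half absorbs the [A] term of [dV], the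
   other leaves decay in [A]. *)
set (U := fun t => V t + 2 * K / rho p * A t).
set (dU := fun t => dV t + 2 * K / rho p * fA p (L t) (Rr t) (A t)).
assert (DU : forall t, 0 <= t -> is_derive U t (dU t)).
{ intros t Ht; apply @is_derive_plus; auto. apply is_derive_scal, Hs, Ht. }
assert (IU : forall t, 0 <= t -> dU t <= - c0 * W t - K * A t).
{ intros t Ht; specialize (IV t Ht); specialize (HfA t Ht); unfold dU.
  assert (2 * K / rho p * fA p (L t) (Rr t) (A t) <= 2 * K / rho p * (- rho p * A t)).
  { apply Rmult_le_compat_l; auto. apply Rle_mult_inv_pos; lra. }
  replace (2 * K / rho p * (- rho p * A t)) with (- 2 * K * A t) in * by (field; lra).
  lra. }
assert (HH : forall x, 0 <= x <= 1 -> g1 / 2 * (x - ths) ^ 2 <= H x <= g2 / 2 * (x - ths) ^ 2).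
{ apply (quadratic_bounds H G); auto; lra. }
assert (KA : forall t, 0 <= t -> 0 <= 2 * K / rho p * A t).
{ intros t Ht; destruct (HT t Ht) as (_ & _ & A1 & _).
  apply Rmult_le_pos; auto; apply Rle_mult_inv_pos; lra. }
assert (HH' : forall t, 0 <= t -> 0 <= H (th t)).
{ intros t Ht; destruct (HH _ (Hth t Ht)); pose proof (pow2_ge_0 (th t - ths)); nra. }
assert (UB : forall t, 0 <= t -> U t <= U 0).
{ intros t Ht; apply (derive_nonpos_decr U dU); auto.
  - intros; apply DU; lra.
  - intros r Hr'; specialize (IU r ltac:(lra)); specialize (HW r).
    destruct (HT r ltac:(lra)) as (_ & _ & A1 & _).
    assert (0 <= c0 * W r) by nra. assert (0 <= K * A r) by nra. lra. }
(* The logarithm in [V1] keeps [N] away from [0]. *)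
set (n0 := Rmin Ns (Ns * exp (- (U 0 + Ns) / Ns))).
assert (Hn0 : 0 < n0 /\ n0 <= Ns).
{ unfold n0; split; [|apply Rmin_l].
  apply Rmin_glb_lt; [lra|]. apply Rmult_lt_0_compat; [lra|apply exp_pos]. }
assert (Nn0 : forall t, 0 <= t -> n0 <= N t).
{ intros t Ht; apply Rle_trans with (1 := Rmin_r _ _).
  specialize (UB t Ht); specialize (KA t Ht); specialize (HH' t Ht).
  destruct (HN t Ht) as [N1 N2]. set (U0 := U 0) in *.
  unfold U, V, V1 in UB.
  (* Dropping the nonnegative terms [N t], [H (th t)] and the multiple of [A t] from [UB] isolates
     the logarithm. *)
  assert (I : - (U0 + Ns) / Ns <= ln (N t) - ln Ns).
  { apply Rmult_le_reg_r with Ns; [lra|].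
    replace (- (U0 + Ns) / Ns * Ns) with (- (U0 + Ns)) by (field; lra). lra. }
  rewrite <- (exp_ln (N t)) by auto. rewrite <- (exp_ln Ns) at 1 by lra.
  rewrite <- exp_plus.
  destruct (Req_dec (ln Ns + - (U0 + Ns) / Ns) (ln (N t))) as [E|E].
  - right; f_equal; auto.
  - left; apply exp_increasing; lra. }
(* The minimum with [Ns] in [n0] puts the centre [Ns] inside [[n0, 1]], where [/ x] lies between [1]
   and [/ n0]. *)
assert (HV1 : forall x, n0 <= x <= 1 ->
   1 / 2 * (x - Ns) ^ 2 <= V1 x <= / n0 / 2 * (x - Ns) ^ 2).
{ apply (quadratic_bounds V1 (fun x => / x)); auto; [lra| |].
  - intros; apply DV1; lra.
  - intros x Hx; split.
    + rewrite <- Rinv_1; apply Rinv_le_contravar; lra.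
    + apply Rinv_le_contravar; lra. }
set (c1 := / n0 + g2).
assert (Hc1 : 0 < c1) by (pose proof (Rinv_0_lt_compat n0 (proj1 Hn0)); unfold c1; lra).
(* The first rate serves the [V] part of [U], the second its [A] part. *)
set (k := Rmin (c0 / c1) (rho p / 2)).
assert (Hk : 0 < k) by (apply Rmin_glb_lt; [apply Rdiv_lt_0_compat; auto|lra]).
set (c2 := Rmin (1 / 2) (g1 / 2)).
assert (Hc2 : 0 < c2) by (apply Rmin_glb_lt; lra).
assert (VW : forall t, 0 <= t -> c2 * W t <= V t <= c1 * W t).
{ intros t Ht; destruct (HV1 (N t)) as [P1 P2]; [specialize (Nn0 t Ht); specialize (HN t Ht); lra|].
  destruct (HH _ (Hth t Ht)) as [P3 P4]. fold (X t) in P1, P2. fold (Y t) in P3, P4.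
  pose proof (pow2_ge_0 (X t)); pose proof (pow2_ge_0 (Y t)).
  assert (M1 : c2 <= 1 / 2) by apply Rmin_l. assert (M2 : c2 <= g1 / 2) by apply Rmin_r.
  pose proof (Rinv_0_lt_compat n0 (proj1 Hn0)).
  unfold V, W, c1; split; nra. }
assert (DecU : forall t, 0 <= t -> dU t <= - k * U t).
{ intros t Ht; apply Rle_trans with (1 := IU t Ht); unfold U.
  destruct (VW t Ht) as [_ P]; specialize (HW t); destruct (HT t Ht) as (_ & _ & A1 & _).
  assert (I1 : k * V t <= c0 * W t).
  { apply Rle_trans with (k * (c1 * W t)); [apply Rmult_le_compat_l; lra|].
    apply Rle_trans with (c0 / c1 * (c1 * W t)).
    - apply Rmult_le_compat_r; [nra|apply Rmin_l].
    - right; field; lra. }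
  assert (I2 : k * (2 * K / rho p * A t) <= K * A t).
  { apply Rle_trans with (rho p / 2 * (2 * K / rho p * A t)).
    - apply Rmult_le_compat_r; [auto|apply Rmin_r].
    - right; field; lra. }
  lra. }
assert (LW : forall t, 0 < t -> W t <= U 0 / c2 * exp (- k * t)).
{ intros t Ht; assert (Ht' : 0 <= t) by lra.
  pose proof (gronwall U dU (- k) t Ht' (fun r Hr => DU r (proj1 Hr))
    (fun r Hr => DecU r (proj1 Hr))) as I.
  destruct (VW t Ht') as [P _]; specialize (KA t Ht'); unfold U in I at 1.
  apply Rmult_le_reg_l with c2; auto.
  replace (c2 * (U 0 / c2 * exp (- k * t))) with (U 0 * exp (- k * t)) by (field; lra). lra. }
assert (LN : is_lim N p_infty Ns).
{ apply is_lim_of_sqr with (fun t => U 0 / c2 * exp (- k * t)).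
  - intros t Ht; specialize (LW t Ht); unfold W in LW; fold (X t).
    pose proof (pow2_ge_0 (Y t)); lra.
  - apply is_lim_scal_exp_neg; auto. }
assert (Lth : is_lim th p_infty ths).
{ apply is_lim_of_sqr with (fun t => U 0 / c2 * exp (- k * t)).
  - intros t Ht; specialize (LW t Ht); unfold W in LW; fold (Y t).
    pose proof (pow2_ge_0 (X t)); lra.
  - apply is_lim_scal_exp_neg; auto. }
assert (LL : is_lim (fun t => th t * N t) p_infty (ths * Ns)).
{ apply (is_lim_mult th N p_infty ths Ns); auto; exact I. }
assert (EL : forall t, 0 < t -> th t * N t = L t).
{ intros t Ht; destruct (HN t ltac:(lra)); unfold th; field; lra. }
split; [|split]; auto.
- apply (is_lim_ext_loc (fun t => th t * N t)); auto. exists 0; auto.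
- replace ((1 - ths) * Ns) with (Ns - ths * Ns) by ring.
  apply (is_lim_ext_loc (fun t => N t - th t * N t)).
  + exists 0; intros t Ht; rewrite EL by auto; unfold N; ring.
  + apply (is_lim_minus N (fun t => th t * N t) p_infty Ns (ths * Ns)); auto. reflexivity.
Qed.

(** * The two regimes of the threshold *)

Theorem theorem6p8 (p : params) (Rrad : R) :
  params_pos p -> is_Rrad p Rrad ->
  (Rrad <= 1 -> GAS_on_T p 0 0 0) /\
  (1 < Rrad ->
     exists Ls Rs : R,
       0 < Ls /\ 0 < Rs /\ in_T Ls Rs 0 /\ is_equilibrium p Ls Rs 0 /\
       (forall L' R' A', in_T L' R' A' -> is_equilibrium p L' R' A' ->
          0 < L' -> 0 < R' -> L' = Ls /\ R' = Rs /\ A' = 0) /\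
       (forall L Rr A : R -> R, is_solution p L Rr A ->
          in_Gamma (L 0) (Rr 0) (A 0) ->
          (forall t, 0 <= t -> in_Gamma (L t) (Rr t) (A t)) /\
          converges_to L Rr A 0 0 0) /\
       (forall L Rr A : R -> R, is_solution p L Rr A ->
          in_T (L 0) (Rr 0) (A 0) -> ~ in_Gamma (L 0) (Rr 0) (A 0) ->
          converges_to L Rr A Ls Rs 0)).
Proof.
intros Hp HR; split; [apply subcritical_GAS; auto|].
intros Hl.
destruct (endemic_equilibrium p Rrad Hp HR Hl) as (H1 & H2 & H3).
set (ths := gammaRL p / (gammaRL p + (Rrad * muL p - alphaL p))) in *.
set (Ns := 1 - / Rrad) in *.
assert (HL : 0 < ths * Ns) by nra.
assert (HRs : 0 < (1 - ths) * Ns) by nra.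
exists (ths * Ns), ((1 - ths) * Ns).
split; [|split; [|split; [|split; [|split; [|split]]]]]; auto.
- unfold in_T; repeat split; lra.
- intros L' R' A' HT He HL' HR'; apply (endemic_equilibrium_unique p); auto.
- intros L Rr A Hs HG; split; [apply (Gamma_invariant p)|apply (Gamma_lim p)]; auto.
- intros L Rr A Hs H0 HG; apply (supercritical_lim p Rrad); auto.
Qed.
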